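(* Let $R$ be a reduced commutative ring with unity. The following statements hold. (1) $R$ is a $W$-ring (resp. $UW$-ring) if and only if for each ideal $I$ of $R$, the ideal $\mathrm{Ann}(I)+\mathrm{Ann}^2(I)$ contains a regular element (resp. a unit). (2) If $R$ is a $W$-ring, then every two disjoint open sets in $\mathrm{Min}(R)$ can be separated by two disjoint basic closed sets; that is, for all disjoint open $A,B\subseteq \mathrm{Min}(R)$ there are $x,y\in R$ with $A\subseteq h_m(x)$, $B\subseteq h_m(y)$ and $h_m(x)\cap h_m(y)=\emptyset$. (3) If $R$ is a $2$-real ring (in particular, if $R$ is a real ring), then the converse of (2) holds: if every two disjoint open sets in $\mathrm{Min}(R)$ can be separated by two disjoint basic closed sets in the sense of (2), then $R$ is a $W$-ring.
   Context: For a subset $S$ of $R$, $\mathrm{Ann}(S)=\{r\in R: rs=0\ \forall s\in S\}$ and $\mathrm{Ann}^2(S)=\mathrm{Ann}(\mathrm{Ann}(S))$. A regular element is a non-zero-divisor. $R$ is a $W$-ring (resp. $UW$-ring) if for each pair of ideals $I,J$ of $R$ with $I\cap J=0$, the ideal $\mathrm{Ann}(I)+\mathrm{Ann}(J)$ contains a regular element (resp. a unit). $\mathrm{Min}(R)$ is the space of minimal prime ideals of $R$ with the hull-kernel topology (the subspace topology from $\mathrm{Spec}(R)$); for $a\in R$, $h_m(a)=\{P\in\mathrm{Min}(R): a\in P\}$, and these sets form a base for the closed sets (''basic closed sets''). For $n\in\mathbb{N}$, $R$ is $n$-real if $a_1^2+\dots+a_n^2=0$ with $a_i\in R$ implies $a_1=\dots=a_n=0$;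 $R$ is real if it is $n$-real for every $n\in\mathbb{N}$. *)

(* Defs.v *)
From HB Require Import structures.
From mathcomp Require Import all_boot all_order all_algebra.
From mathcomp Require Import boolp classical_sets functions topology.

Set Implicit Arguments.
Unset Strict Implicit.
Unset Printing Implicit Defensive.
Import GRing.Theory.
Local Open Scope classical_set_scope.
Local Open Scope ring_scope.

(* Ideals are Prop-valued sets rather than the [idealr] predicates of
   ring_quotient, which are boolean and proper by definition: the ideals
   below range over all ideals, including the whole ring. *)
Definition is_ideal (R : comPzRingType) (I : set R) : Prop :=
  [/\ I 0,
      forall x y, I x -> I y -> I (x + y) &
      forall r x, I x -> I (r * x)].

Definition is_prime_ideal (R : comPzRingType) (P : set R) : Prop :=
  [/\ is_ideal P, ~ P 1 & forall x y, P (x * y) -> P x \/ P y].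

Definition ideal_add (R : comPzRingType) (I J : set R) : set R :=
  [set x + y | x in I & y in J].

Definition Ann (R : comPzRingType) (S : set R) : set R :=
  [set r | forall s, S s -> r * s = 0].

Definition Ann2 (R : comPzRingType) (S : set R) : set R := Ann (Ann S).

Definition reduced (R : comPzRingType) : Prop :=
  forall (x : R) (n : nat), x ^+ n = 0 -> x = 0.

(* [GRing.lreg x] says that multiplication by [x] is injective. *)
Definition has_regular (R : comPzRingType) (S : set R) : Prop :=
  exists2 x, S x & GRing.lreg x.

(* [GRing.unit] would require a [comUnitRingType] structure on [R]. *)
Definition has_unit (R : comPzRingType) (S : set R) : Prop :=
  exists2 x, S x & exists y, x * y = 1.

Definition W_ring (R : comPzRingType) : Prop :=
  forall I J : set R, is_ideal I -> is_ideal J -> I `&` J = [set 0] ->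
    has_regular (ideal_add (Ann I) (Ann J)).

Definition UW_ring (R : comPzRingType) : Prop :=
  forall I J : set R, is_ideal I -> is_ideal J -> I `&` J = [set 0] ->
    has_unit (ideal_add (Ann I) (Ann J)).

Definition n_real (n : nat) (R : comPzRingType) : Prop :=
  forall a : 'I_n -> R, \sum_(i < n) a i ^+ 2 = 0 -> forall i, a i = 0.

Definition real_ring (R : comPzRingType) : Prop := forall n, n_real n R.

Record Spec (R : comPzRingType) := MkSpec {
  spec_set :> set R;
  spec_prime : is_prime_ideal spec_set
}.

HB.instance Definition _ (R : comPzRingType) := gen_eqMixin (Spec R).
HB.instance Definition _ (R : comPzRingType) := gen_choiceMixin (Spec R).

Section HullKernelTopology.
Variable R : comPzRingType.

Definition hull (S : set R) : set (Spec R) :=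
  [set P : Spec R | S `<=` P].

Definition spec_open : set (set (Spec R)) :=
  [set U | exists S : set R, U = ~` hull S].

Let spec_openT : spec_open setT.
Proof.
exists setT; apply/esym; rewrite -subTset => P _ /= /(_ 1 I) P1.
by case: (spec_prime P) => _ /(_ P1).
Qed.

Let spec_openI : setI_closed spec_open.
Proof.
move=> _ _ [S ->] [T ->]; exists [set x * y | x in S & y in T].
apply/seteqP; split=> P /=.
  move=> [SP TP] STP.
  have [_ _ PM] := spec_prime P.
  apply: SP => x Sx; apply: contrapT => nPx; apply: TP => y Ty.
  by case: (PM x y) => //; apply: STP; exists x => //; exists y.
have [[_ _ PM] _ _] := spec_prime P.
move=> nP; split=> sP; apply: nP => _ [x Sx [y Ty <-]].
  by rewrite mulrC; apply/PM/sP.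
by apply/PM/sP.
Qed.

Let spec_open_bigcup (I : Type) (f : I -> set (Spec R)) :
  (forall i, spec_open (f i)) -> spec_open (\bigcup_i f i).
Proof.
move=> /choice[S fS]; exists (\bigcup_i S i).
apply/seteqP; split=> P /=.
  move=> [i _]; rewrite fS => nSP SP; apply: nSP => x Sx.
  by apply: SP; exists i.
move=> nSP; apply: contrapT => nP; apply: nSP => x [i _ Six].
apply: contrapT => nPx; apply: nP; exists i => //; rewrite fS => SP.
exact/nPx/SP.
Qed.

HB.instance Definition _ := isOpenTopological.Build (Spec R)
  spec_openT spec_openI spec_open_bigcup.

End HullKernelTopology.

Definition minimal_prime (R : comPzRingType) : set (Spec R) :=
  [set P | forall Q : Spec R, Q `<=` P -> P `<=` Q].

(* The topology on [set_type] is the subspace topology. *)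
Notation Min R := (set_type (@minimal_prime R)).

Definition h_m (R : comPzRingType) (a : R) : set (Min R) :=
  [set P : Min R | spec_set (set_val P) a].

Definition Min_separated (R : comPzRingType) : Prop :=
  forall A B : set (Min R), open A -> open B -> A `&` B = set0 ->
    exists x y : R,
      [/\ A `<=` h_m x, B `<=` h_m y & h_m x `&` h_m y = set0].

(* Main.v *)
(* In a reduced ring a maximal multiplicative set avoiding 0 is the complement
   of a minimal prime, so minimal primes intersect in 0 and consist of zero
   divisors.  Disjoint open sets of Min(R), given by S and T, then mean S T = 0,
   and a regular x + y with x in Ann(Ann S), y in Ann(Ann(Ann S)) = Ann S
   yields the separating sets h_m(y), h_m(x).  Conversely, separating the
   open sets of I and Ann I gives x in Ann I and y in Ann(Ann I) with no common
   minimal prime, and x y = 0 makes x + y regular. *)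
Require Import Defs.
From mathcomp Require Import all_boot all_order all_algebra.
From mathcomp Require Import boolp classical_sets functions topology.

Set Implicit Arguments.
Unset Strict Implicit.
Unset Printing Implicit Defensive.
Import GRing.Theory.
Local Open Scope classical_set_scope.
Local Open Scope ring_scope.

(** * Annihilators and sums of ideals *)

Section Annihilators.
Variable R : comPzRingType.
Implicit Types (S T I J : set R).

Lemma Ann_ideal S : is_ideal (Ann S).
Proof.
split=> [s _|x y Sx Sy s Ss|r x Sx s Ss]; first by rewrite mul0r.
- by rewrite mulrDl Sx// Sy// addr0.
- by rewrite -mulrA Sx// mulr0.
Qed.

Lemma sub_Ann S T : S `<=` Ann T -> T `<=` Ann S.
Proof. by move=> ST t Tt s Ss; rewrite mulrC ST. Qed.

Lemma AnnS S T : S `<=` T -> Ann T `<=` Ann S.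
Proof. by move=> ST r Tr s /ST/Tr. Qed.

Lemma sub_Ann2 S : S `<=` Ann2 S.
Proof. exact: sub_Ann. Qed.

Lemma ideal_addSr I J K : J `<=` K -> ideal_add I J `<=` ideal_add I K.
Proof. by move=> JK _ [x Ix [y /JK Ky <-]]; exists x => //; exists y. Qed.

Lemma has_regularS S T : S `<=` T -> has_regular S -> has_regular T.
Proof. by move=> ST [x /ST]; exists x. Qed.

Lemma has_unitS S T : S `<=` T -> has_unit S -> has_unit T.
Proof. by move=> ST [x /ST]; exists x. Qed.

Lemma lregP0 (a : R) : (forall r, r * a = 0 -> r = 0) -> GRing.lreg a.
Proof.
move=> reg r s /eqP; rewrite -subr_eq0 -mulrBr mulrC => /eqP/reg/eqP.
by rewrite subr_eq0 => /eqP.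
Qed.

Lemma spec_sub_mul S T (P : Spec R) :
  S `<=` Ann T -> ~ S `<=` P -> T `<=` P.
Proof.
have [[P0 _ _] _ PM] := spec_prime P.
move=> ST nSP t Tt; apply: contrapT => nPt; apply: nSP => s Ss.
by case: (PM s t) => //; rewrite (ST s).
Qed.

End Annihilators.

(** * Reduced rings and pairs of ideals meeting in 0 *)

Section ReducedRing.
Variable R : comPzRingType.
Hypothesis Rred : reduced R.
Implicit Types (S T I J M : set R) (P : Min R).

Lemma reduced_sq (x : R) : x * x = 0 -> x = 0.
Proof. by move=> xx; apply: (Rred (n := 2)); rewrite expr2. Qed.

Lemma setI_Ann I : is_ideal I -> I `&` Ann I = [set 0].
Proof.
move=> [I0 _ _]; apply/seteqP; split=> [x [Ix Ax]|_ ->].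
  exact/reduced_sq/Ax.
by split=> // s _; rewrite mul0r.
Qed.

(** Abstracting over [Q] settles the regular and the unit case at once. If I and J meet in 0, then J
    I = 0, so J lies in Ann I and [Ann2 I] in Ann J; conversely J := Ann I is admissible since it
    meets I in 0. *)
Lemma disjoint_ideals_Ann_Ann2 (Q : set R -> Prop) :
    (forall S T, S `<=` T -> Q S -> Q T) ->
  (forall I J, is_ideal I -> is_ideal J -> I `&` J = [set 0] ->
     Q (ideal_add (Ann I) (Ann J))) <->
  (forall I, is_ideal I -> Q (ideal_add (Ann I) (Ann2 I))).
Proof.
move=> QS; split=> [QIJ I iI|QI I J iI iJ IJ0].
  by apply: QIJ => //; [exact: Ann_ideal|exact: setI_Ann].
apply: QS (QI I iI); apply/ideal_addSr/AnnS => j Jj i Ii.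
have : (I `&` J) (j * i).
  by split; [case: iI => _ _; exact|rewrite mulrC; case: iJ => _ _; exact].
by rewrite IJ0.
Qed.

(** * Multiplicative sets and minimal primes *)

Definition mult_closed M := M 1 /\ forall x y, M x -> M y -> M (x * y).

(** For maximal N, adjoining x outside N must produce 0 in the form s x^n; reducedness then gives s
    x = 0. *)
Lemma maximal_mult_closed M : mult_closed M -> ~ M 0 ->
  exists N, [/\ M `<=` N, mult_closed N, ~ N 0 &
    forall x, ~ N x -> exists2 s, N s & s * x = 0].
Proof.
move=> [M1 MM] M0.
(* Ranging over the sets M `|` X makes the empty chain unproblematic. *)
pose p X := mult_closed (M `|` X) /\ ~ (M `|` X) 0.
have [|X [[[N1 NM] N0] Xmax]] := @Zorn_bigcup R p.
  move=> F Fp Ftot; split; last first.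
    case=> // -[X FX X0]; have [_] := Fp X FX; apply; by right.
  split; first by left.
  have mulF X x y : F X -> (M `|` X) x -> (M `|` X) y ->
      (M `|` \bigcup_(X in F) X) (x * y).
    move=> FX Xx Xy; have [[_ XM] _] := Fp X FX.
    by case: (XM x y Xx Xy) => [?|?]; [left|right; exists X].
  move=> x y [Mx|[X FX Xx]] [My|[Y FY Yy]].
  - by left; apply: MM.
  - by apply: (mulF Y) => //; [left|right].
  - by apply: (mulF X) => //; [right|left].
  - have [XY|YX] := Ftot X Y FX FY.
      by apply: (mulF Y) => //; right => //; apply: XY.
    by apply: (mulF X) => //; right => //; apply: YX.
exists (M `|` X); split=> // x Nx.
(* The multiplicative set generated by [M]|[X] and x. *)
pose B := [set s * x ^+ n | s in M `|` X & n in [set: nat]].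
have NB : M `|` X `<=` B.
  by move=> s Ns; exists s => //; exists 0 => //; rewrite expr0 mulr1.
have Bx : B x.
  by exists 1 => //; exists 1 => //; rewrite mul1r expr1.
have XB : X `<` B.
  split=> [s Xs|BX]; first by apply: NB; right.
  by apply: Nx; right; apply: BX.
have MB : M `|` B = B.
  by apply/setUidPr => s Ms; apply: NB; left.
have [n [s Ns sxn]] : exists n, exists2 s, (M `|` X) s & s * x ^+ n = 0.
  apply: contrapT => nB0; apply: (Xmax B) => //; rewrite /p MB; split.
    split=> [|_ _ [s Ns [m _ <-]] [t Nt [n _ <-]]]; first exact: NB.
    exists (s * t); first exact: NM.
    by exists (m + n)%N => //; rewrite exprD mulrACA.
  by move=> [s Ns [n _ sxn]]; apply: nB0; exists n, s.
(* The exponent is n + 1 because for n = 0 the power (s x)^n is 1. *)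
exists s => //; apply: (Rred (n := n.+1)).
by rewrite exprMn exprS exprSr mulrACA sxn mul0r.
Qed.

(** The complement of a maximal N consists of the elements killed by some s in N. A prime Q inside
    it misses s, so s x = 0 puts x in Q: hence minimality. *)
Lemma min_prime_avoiding M : mult_closed M -> ~ M 0 ->
  exists P, forall x, M x -> ~ spec_set (set_val P) x.
Proof.
move=> Mmul M0; have [N [MN [N1 NM] N0 Nmax]] := maximal_mult_closed Mmul M0.
have killP x s : N s -> s * x = 0 -> (~` N) x.
  by move=> Ns sx Nx; apply: N0; rewrite -sx; apply: NM.
have primeP : is_prime_ideal (~` N).
  split=> [|/(_ N1)//|x y nxy]; last first.
    apply: contrapT => /not_orP[/contrapT Nx /contrapT Ny].
    exact/nxy/NM.
  split=> // [x y /Nmax[s Ns sx] /Nmax[t Nt ty]|r x /Nmax[s Ns sx]].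
    apply: (killP _ (s * t)); first exact: NM.
    by rewrite mulrDr mulrAC sx mul0r add0r -mulrA ty mulr0.
  by apply: (killP _ s) => //; rewrite mulrCA sx mulr0.
have minP : MkSpec primeP \in @minimal_prime R.
  rewrite inE => Q QP x /Nmax[s Ns sx].
  have [[Q0 _ _] _ QM] := spec_prime Q.
  by case: (QM s x) => //; [rewrite sx|move=> /QP].
by exists (exist _ (MkSpec primeP) minP) => x /MN Nx /(_ Nx).
Qed.

Lemma min_primes_eq0 (a : R) :
  (forall P, spec_set (set_val P) a) -> a = 0.
Proof.
move=> aP; apply: contrapT => a0.
have [|[n _ /Rred//]|P avoidP] :=
    @min_prime_avoiding [set a ^+ n | n in [set: nat]].
  split=> [|_ _ [m _ <-] [n _ <-]]; first by exists 0; rewrite ?expr0.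
  by exists (m + n)%N => //; rewrite exprD.
by apply: (avoidP a) => //; exists 1; rewrite ?expr1.
Qed.

(** If no b a^n with b outside P were 0, a minimal prime avoiding all these products would lie in P
    and miss a, against the minimality of P. *)
Lemma min_prime_zero_divisor P (a : R) : spec_set (set_val P) a ->
  exists2 b, ~ spec_set (set_val P) b & b * a = 0.
Proof.
move=> Pa; have [_ P1 PM] := spec_prime (set_val P).
pose M := [set b * a ^+ n | b in ~` spec_set (set_val P) & n in [set: nat]].
have [[b Pb [n _ ban]]|M0] := pselect (M 0).
  exists b => //; apply: (Rred (n := n.+1)).
  by rewrite exprMn exprS exprSr mulrACA ban mul0r.
have [|Q avoidQ] := min_prime_avoiding _ M0.
  split=> [|_ _ [b Pb [m _ <-]] [c Pc [n _ <-]]].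
    by exists 1 => //; exists 0 => //; rewrite expr0 mulr1.
  exists (b * c); first by move=> /PM[].
  by exists (m + n)%N => //; rewrite exprD mulrACA.
have QP : set_val Q `<=` set_val P.
  move=> b Qb; apply: contrapT => Pb; apply: (avoidQ b) => //.
  by exists b => //; exists 0 => //; rewrite expr0 mulr1.
have /set_mem minP := valP P.
exfalso; apply: (avoidQ a); last exact: (minP _ QP).
by exists 1 => //; exists 1; rewrite ?mul1r.
Qed.

Lemma min_prime_not_lreg P (a : R) : spec_set (set_val P) a -> ~ GRing.lreg a.
Proof.
move=> /min_prime_zero_divisor[b Pb ba] rega; apply: Pb.
suff -> : b = 0 by case: (spec_prime (set_val P)) => -[].
by apply: rega; rewrite mulr0 mulrC.
Qed.

(** * Separation in Min(R) and the W-ring condition *)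

Lemma Min_openP (A : set (Min R)) : open A <->
  exists S, A = [set P | ~ S `<=` spec_set (set_val P)].
Proof.
split=> [[_ [S ->] <-]|[S ->]]; first by exists S.
by exists (~` hull S) => //; exists S.
Qed.

Lemma W_ring_Min_separated : W_ring R -> Min_separated R.
Proof.
move=> /(disjoint_ideals_Ann_Ann2 (@has_regularS R)) WR.
move=> _ _ /Min_openP[S ->] /Min_openP[T ->] ST0.
(* A minimal prime missing t s would belong to both open sets. *)
have TS : T `<=` Ann S.
  move=> t Tt s Ss; apply: min_primes_eq0 => P.
  have [[_ _ PMr] _ _] := spec_prime (set_val P).
  apply: contrapT => nPts.
  suff : (set0 : set (Min R)) P by [].
  rewrite -ST0; split=> PST; apply: nPts; first exact/PMr/PST.
  by rewrite mulrC; exact/PMr/PST.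
have [_ [x Sx [y Sy <-]] xy_reg] := WR _ (Ann_ideal S).
(* The order is swapped: y kills S, and x kills Ann S, which contains T; a prime not containing a
   set contains whatever kills that set. *)
exists y, x; split.
- move=> P nSP; apply: (spec_sub_mul _ nSP) Sy.
  exact: (subset_trans (@sub_Ann2 R S) (@sub_Ann2 R _)).
- move=> P nTP; apply: (spec_sub_mul _ nTP) Sx.
  exact: (subset_trans TS (@sub_Ann2 R _)).
- apply/seteqP; split=> // P [Py Px].
  have [[_ PD _] _ _] := spec_prime (set_val P).
  by case: (min_prime_not_lreg (PD _ _ Px Py)).
Qed.

(** Each minimal prime contains S or x, hence every product x s. *)
Lemma Min_open_sub_h_m S (x : R) :
  [set P : Min R | ~ S `<=` spec_set (set_val P)] `<=` h_m x -> Ann S x.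
Proof.
move=> Sx s Ss; apply: min_primes_eq0 => P.
have [[_ _ PMr] _ _] := spec_prime (set_val P).
have [/(_ s Ss)|/Sx Px] := pselect (S `<=` spec_set (set_val P)).
  exact: PMr.
by rewrite mulrC; exact: PMr.
Qed.

(** If r (x + y) = 0, multiplying by x gives r x^2 = 0, so r x = 0 and then r y = 0. A minimal prime
    missing r would contain both x and y. *)
Lemma lreg_add_disjoint_h_m (x y : R) :
  x * y = 0 -> h_m x `&` h_m y = set0 -> GRing.lreg (x + y).
Proof.
move=> xy0 hxy; apply: lregP0 => r rxy.
have rx0 : r * x = 0.
  apply: reduced_sq; rewrite mulrACA -mulrA.
  have -> : r * (x * x) = r * (x + y) * x.
    by rewrite mulrDr mulrDl -!mulrA [y * x]mulrC xy0 mulr0 addr0.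
  by rewrite rxy mul0r mulr0.
have ry0 : r * y = 0 by move: rxy; rewrite mulrDr rx0 add0r.
apply: min_primes_eq0 => P; apply: contrapT => nPr.
have [[P0 _ _] _ PM] := spec_prime (set_val P).
suff : (set0 : set (Min R)) P by [].
rewrite -hxy; split.
- by case: (PM r x) => //; rewrite rx0.
- by case: (PM r y) => //; rewrite ry0.
Qed.

Lemma Min_separated_W_ring : Min_separated R -> W_ring R.
Proof.
move=> sep; apply/(disjoint_ideals_Ann_Ann2 (@has_regularS R)) => I iI.
have openI S : open [set P : Min R | ~ S `<=` spec_set (set_val P)].
  by apply/Min_openP; exists S.
have [|x [y [Ix AIy hxy]]] := sep _ _ (openI I) (openI (Ann I)).
  apply/seteqP; split=> // P [nIP]; apply.
  exact: (spec_sub_mul (@sub_Ann2 R I)) nIP.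
have {}Ix := Min_open_sub_h_m Ix; have {}AIy := Min_open_sub_h_m AIy.
exists (x + y); first by exists x => //; exists y.
by apply: lreg_add_disjoint_h_m => //; rewrite mulrC; exact: AIy.
Qed.

End ReducedRing.

Theorem theorem4p8 (R : comPzRingType) (Rred : reduced R) :
  ((W_ring R <->
      forall I : set R, is_ideal I ->
        has_regular (ideal_add (Ann I) (Ann2 I))) /\
   (UW_ring R <->
      forall I : set R, is_ideal I ->
        has_unit (ideal_add (Ann I) (Ann2 I)))) /\
  (W_ring R -> Min_separated R) /\
  ((n_real 2 R -> Min_separated R -> W_ring R) /\
   (real_ring R -> Min_separated R -> W_ring R)).
Proof.
split; first split.
- exact: disjoint_ideals_Ann_Ann2 (@has_regularS R).
- exact: disjoint_ideals_Ann_Ann2 (@has_unitS R).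
- split; first exact: W_ring_Min_separated.
  by split=> _; exact: Min_separated_W_ring.
Qed.
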